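(* For every set $\Gamma\cup\{\phi\}$ of $\mathbf{MD}^\vee$-formulas: $\Gamma\models\phi$ if and only if $\Gamma\vdash_{\mathbf{MD}^\vee}\phi$.
   Context: **Language of $\mathbf{MD}^\vee$.** Fix a set $\mathrm{Prop}$ of propositional variables. Classical formulas: $\alpha::=p\mid\bot\mid\neg\alpha\mid\alpha\wedge\alpha\mid\alpha\otimes\alpha\mid\Box\alpha\mid\Diamond\alpha$. Formulas: $\phi::=\alpha\mid\;=\!(\alpha_1,\dots,\alpha_n,\beta)\mid\phi\wedge\phi\mid\phi\otimes\phi\mid\phi\vee\phi\mid\Box\phi\mid\Diamond\phi$, where $n\ge0$ and $\alpha,\alpha_i,\beta$ are classical. Negation applies to classical formulas only. **Team semantics.** A Kripke model is $\mathfrak{M}=(W,R,V)$ with $W\neq\emptyset$, $R\subseteq W\times W$, $V:\mathrm{Prop}\to\wp(W)$. A team is any $X\subseteq W$. $R(X)=\{w\in W\mid\exists v\in X,\ vRw\}$, $R(w)=R(\{w\})$; $XRY$ means $Y\subseteq R(X)$ and $Y\cap R(w)\ne\emptyset$ for every $w\in X$. Satisfaction: - $\mathfrak{M},X\models p$ iff $X\subseteq V(p)$; $\mathfrak{M},X\models\bot$ iff $X=\emptyset$; $\mathfrak{M},X\models\neg\alpha$ iff $\mathfrak{M},\{w\}\not\models\alpha$ for all $w\in X$. - $\mathfrak{M},X\models\phi\wedge\psi$ iff both hold on $X$; $\mathfrak{M},X\models\phi\vee\psi$ iff $\mathfrak{M},X\models\phi$ or $\mathfrak{M},X\models\psi$.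 - $\mathfrak{M},X\models\phi\otimes\psi$ iff $X=Y\cup Z$ for some $Y,Z\subseteq X$ with $\mathfrak{M},Y\models\phi$, $\mathfrak{M},Z\models\psi$. - $\mathfrak{M},X\models\Box\phi$ iff $\mathfrak{M},R(X)\models\phi$; $\mathfrak{M},X\models\Diamond\phi$ iff there is $Y\subseteq W$ with $XRY$ and $\mathfrak{M},Y\models\phi$. - $\mathfrak{M},X\models\;=\!(\alpha_1,\dots,\alpha_n,\beta)$ iff for all $w,u\in X$: if ($\mathfrak{M},\{w\}\models\alpha_i\Leftrightarrow\mathfrak{M},\{u\}\models\alpha_i$) for all $1\le i\le n$, then ($\mathfrak{M},\{w\}\models\beta\Leftrightarrow\mathfrak{M},\{u\}\models\beta$). $\Gamma\models\phi$ means: for all models $\mathfrak{M}$ and teams $X$, if $\mathfrak{M},X\models\gamma$ for all $\gamma\in\Gamma$ then $\mathfrak{M},X\models\phi$. **Natural deduction system of $\mathbf{MD}^\vee$.** ($\phi,\psi,\chi,\dots$ range over formulas, $\alpha,\alpha_i,\beta$ over classical formulas; $[\cdot]$ marks discharged assumptions; subderivations may use further undischarged assumptions unless stated otherwise.) - Conjunction: from $\phi$ and $\psi$ infer $\phi\wedge\psi$; from $\phi\wedge\psi$ infer $\phi$; from $\phi\wedge\psi$ infer $\psi$. - From $\neg\neg\alpha$ infer $\alpha$; from $\bot$ infer $\phi$. - $\neg$I: from a derivation of $\bot$ from $[\alpha]$ infer $\neg\alpha$. $\neg$E: from $\alpha$ and $\neg\alpha$ infer $\bot$. - $\Box$Mon: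 from $\Box\phi_1,\dots,\Box\phi_k$ ($k\ge0$) and a derivation of $\psi$ from $[\phi_1],\dots,[\phi_k]$ having no other undischarged assumptions, infer $\Box\psi$. - $\Diamond$Mon: from $\Diamond\phi$ and a derivation of $\psi$ from $[\phi]$ having no other undischarged assumptions, infer $\Diamond\psi$. - From $\neg\Box\alpha$ infer $\Diamond\neg\alpha$; from $\Diamond\neg\alpha$ infer $\neg\Box\alpha$. - Intuitionistic disjunction: from $\phi$ infer $\phi\vee\psi$; from $\psi$ infer $\phi\vee\psi$; from $\phi\vee\psi$, a derivation of $\chi$ from $[\phi]$ and a derivation of $\chi$ from $[\psi]$, infer $\chi$. - Distributivity: from $\phi\otimes(\psi\vee\chi)$ infer $(\phi\otimes\psi)\vee(\phi\otimes\chi)$; from $\Diamond(\phi\vee\psi)$ infer $\Diamond\phi\vee\Diamond\psi$; from $\Box(\phi\vee\psi)$ infer $\Box\phi\vee\Box\psi$. - Tensor: from $\phi$ infer $\phi\otimes\psi$; from $\phi\otimes\psi$ infer $\psi\otimes\phi$; from $\phi\otimes(\psi\otimes\chi)$ infer $(\phi\otimes\psi)\otimes\chi$; from $\phi\otimes\psi$, a derivation of $\alpha$ from $[\phi]$ and a derivation of $\alpha$ from $[\psi]$ ($\alpha$ classical), infer $\alpha$; from $\phi\otimes\psi$ and a derivation of $\chi$ from $[\psi]$, infer $\phi\otimes\chi$. - Dependence atoms (both directions): $=\!(\alpha_1,\dots,\alpha_k,\beta)$ and $\bigotimes_{v\in 2^{\{1,\dots,k\}}}(\alpha_1^{v(1)}\wedge\dots\wedge\alpha_k^{v(k)}\wedge(\beta\vee\neg\beta))$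 may be inferred from each other, where $2=\{0,1\}$, $\gamma^1=\gamma$, $\gamma^0=\neg\gamma$. $\Gamma\vdash_{\mathbf{MD}^\vee}\phi$ means there is a derivation of $\phi$ all of whose undischarged assumptions belong to $\Gamma$. *)

(* Defs.v *)
From mathcomp Require Import all_boot.
From mathcomp Require Import boolp classical_sets.

Set Implicit Arguments.
Unset Strict Implicit.
Unset Printing Implicit Defensive.

Local Open Scope classical_set_scope.

Inductive cform (PV : Type) : Type :=
| cVar of PV
| cBot
| cNeg of cform PV
| cAnd of cform PV & cform PV
| cTens of cform PV & cform PV
| cBox of cform PV
| cDia of cform PV.

Arguments cBot {PV}.

(** The clause "phi ::= alpha" of the grammar is inlined: each constructor of
    [cform] reappears in [form], [fNeg] keeping a classical argument.  Every
    formula thus has a single representation, and the classical formulas are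
    the image of the injection [emb] below. *)
Inductive form (PV : Type) : Type :=
| fVar of PV
| fBot
| fNeg of cform PV
| fDep (n : nat) of n.-tuple (cform PV) & cform PV
| fAnd of form PV & form PV
| fTens of form PV & form PV
| fOr of form PV & form PV
| fBox of form PV
| fDia of form PV.

Arguments fBot {PV}.

Fixpoint emb (PV : Type) (a : cform PV) : form PV :=
  match a with
  | cVar p => fVar p
  | cBot => fBot
  | cNeg a => fNeg a
  | cAnd a b => fAnd (emb a) (emb b)
  | cTens a b => fTens (emb a) (emb b)
  | cBox a => fBox (emb a)
  | cDia a => fDia (emb a)
  end.

Lemma emb_inj (PV : Type) : injective (@emb PV).
Proof.
by elim=> [p||a IHa|a IHa b IHb|a IHa b IHb|a IHa|a IHa] [] //= *;
  match goal with H : _ = _ |- _ => case: H => *; f_equal; auto end.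
Qed.

Record kripke (PV : Type) : Type := Kripke {
  world :> Type;
  world_nonempty : inhabited world;
  acc : world -> world -> Prop;
  valuation : PV -> set world
}.

Section Semantics.
Context {PV : Type} (M : kripke PV).
Implicit Types X Y Z : set M.

Definition succs X : set M := [set w | exists2 v, X v & acc v w].

Definition team_rel X Y : Prop :=
  Y `<=` succs X /\ (forall w, X w -> (Y `&` succs [set w]) !=set0).

(** The satisfaction clauses for classical formulas, needed on their own by
    the clauses for negation and dependence atoms; [sat_emb] shows that the two
    relations agree. *)
Fixpoint csat X (a : cform PV) : Prop :=
  match a with
  | cVar p => X `<=` valuation p
  | cBot => X = set0
  | cNeg a => forall w, X w -> ~ csat [set w] a
  | cAnd a b => csat X a /\ csat X b
  | cTens a b => exists Y Z,
      [/\ Y `<=` X, Z `<=` X, X = Y `|` Z, csat Y a & csat Z b]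
  | cBox a => csat (succs X) a
  | cDia a => exists2 Y, team_rel X Y & csat Y a
  end.

Fixpoint sat X (f : form PV) : Prop :=
  match f with
  | fVar p => X `<=` valuation p
  | fBot => X = set0
  | fNeg a => forall w, X w -> ~ csat [set w] a
  | fDep n a b => forall w u, X w -> X u ->
      (forall i : 'I_n, csat [set w] (tnth a i) <-> csat [set u] (tnth a i)) ->
      (csat [set w] b <-> csat [set u] b)
  | fAnd f g => sat X f /\ sat X g
  | fTens f g => exists Y Z,
      [/\ Y `<=` X, Z `<=` X, X = Y `|` Z, sat Y f & sat Z g]
  | fOr f g => sat X f \/ sat X g
  | fBox f => sat (succs X) f
  | fDia f => exists2 Y, team_rel X Y & sat Y f
  end.

Lemma sat_emb (a : cform PV) X : sat X (emb a) = csat X a.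
Proof.
elim: a X => //= [a IHa b IHb|a IHa b IHb|a IHa] X.
- by rewrite IHa IHb.
- by apply: eq_exists => Y; apply: eq_exists => Z; rewrite IHa IHb.
- by rewrite propeqE; split=> -[Y XY]; exists Y; rewrite // ?IHa // -IHa.
Qed.

End Semantics.

Definition entails (PV : Type) (G : set (form PV)) (f : form PV) : Prop :=
  forall (M : kripke PV) (X : set M), (forall g, G g -> sat X g) -> sat X f.

(** [fBot] for the empty sequence is a junk value; no [fBot] is appended to a
    nonempty tensor. *)
Fixpoint bigtens (PV : Type) (s : seq (form PV)) : form PV :=
  match s with
  | [::] => fBot
  | [:: f] => f
  | f :: s' => fTens f (bigtens s')
  end.

Definition cpow (PV : Type) (a : cform PV) (e : bool) : cform PV :=
  if e then a else cNeg a.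

Definition dep_cell (PV : Type) (n : nat) (a : n.-tuple (cform PV))
    (b : cform PV) (v : {ffun 'I_n -> bool}) : form PV :=
  foldr (@fAnd PV) (fOr (emb b) (fNeg b))
    [seq emb (cpow (tnth a i) (v i)) | i <- enum 'I_n].

Definition dep_expansion (PV : Type) (n : nat) (a : n.-tuple (cform PV))
    (b : cform PV) : form PV :=
  bigtens [seq dep_cell a b v | v <- enum {: {ffun 'I_n -> bool}}].

(** [derivable G f]: there is a natural deduction derivation of [f] all of
    whose undischarged assumptions lie in [G].  A subderivation in which
    assumptions are discharged may use them in addition to [G]; where no other
    undischarged assumption is allowed, they are its whole context. *)
Inductive derivable (PV : Type) : set (form PV) -> form PV -> Prop :=
| dAssume G f : G f -> derivable G f
| dAndI G f g : derivable G f -> derivable G g -> derivable G (fAnd f g)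
| dAndEl G f g : derivable G (fAnd f g) -> derivable G f
| dAndEr G f g : derivable G (fAnd f g) -> derivable G g
| dNegNegE G a : derivable G (fNeg (cNeg a)) -> derivable G (emb a)
| dExFalso G f : derivable G fBot -> derivable G f
| dNegI G a : derivable (G `|` [set emb a]) fBot -> derivable G (fNeg a)
| dNegE G a : derivable G (emb a) -> derivable G (fNeg a) -> derivable G fBot
| dBoxMon G (k : nat) (f : 'I_k -> form PV) g :
    (forall i, derivable G (fBox (f i))) -> derivable (range f) g ->
    derivable G (fBox g)
| dDiaMon G f g :
    derivable G (fDia f) -> derivable [set f] g -> derivable G (fDia g)
| dNegBox G a : derivable G (fNeg (cBox a)) -> derivable G (fDia (fNeg a))
| dDiaNeg G a : derivable G (fDia (fNeg a)) -> derivable G (fNeg (cBox a))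
| dOrIl G f g : derivable G f -> derivable G (fOr f g)
| dOrIr G f g : derivable G g -> derivable G (fOr f g)
| dOrE G f g h :
    derivable G (fOr f g) -> derivable (G `|` [set f]) h ->
    derivable (G `|` [set g]) h -> derivable G h
| dTensOr G f g h :
    derivable G (fTens f (fOr g h)) ->
    derivable G (fOr (fTens f g) (fTens f h))
| dDiaOr G f g :
    derivable G (fDia (fOr f g)) -> derivable G (fOr (fDia f) (fDia g))
| dBoxOr G f g :
    derivable G (fBox (fOr f g)) -> derivable G (fOr (fBox f) (fBox g))
| dTensI G f g : derivable G f -> derivable G (fTens f g)
| dTensC G f g : derivable G (fTens f g) -> derivable G (fTens g f)
| dTensA G f g h :
    derivable G (fTens f (fTens g h)) -> derivable G (fTens (fTens f g) h)
| dTensE G f g a :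
    derivable G (fTens f g) -> derivable (G `|` [set f]) (emb a) ->
    derivable (G `|` [set g]) (emb a) -> derivable G (emb a)
| dTensSub G f g h :
    derivable G (fTens f g) -> derivable (G `|` [set g]) h ->
    derivable G (fTens f h)
| dDepE G (n : nat) (a : n.-tuple (cform PV)) b :
    derivable G (fDep a b) -> derivable G (dep_expansion a b)
| dDepI G (n : nat) (a : n.-tuple (cform PV)) b :
    derivable G (dep_expansion a b) -> derivable G (fDep a b).

(* Main.v *)
Require Import Defs.
From HB Require Import structures.
From mathcomp Require Import all_boot.
From mathcomp Require Import boolp classical_sets.

(** Classical formulas are flat: a team satisfies them iff each of its points
    does.  This gives soundness, all formulas being downward closed.

    Conversely, the distributivity rules make every formula interderivable with
    an intuitionistic disjunction of classical formulas.  If [G] does not derive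
    [f], extend it by Zorn's lemma to a theory [D] maximal among those not
    deriving [f]; [D] is prime, so each of its members follows from a classical
    formula in [D].  In the canonical model, whose worlds are the maximal
    consistent sets, take the team of all worlds containing [D].  By flatness it
    satisfies the classical part of [D], hence [G].  Were [f] true on it, so
    would be some classical [a] deriving [f]; but [D] does not derive [a], so
    some world of the team contains [D] and the negation of [a]. *)

Set Implicit Arguments.
Unset Strict Implicit.
Unset Printing Implicit Defensive.

Local Open Scope classical_set_scope.

(** * Flatness and downward closure in team semantics *)

Section Semantics.
Context {PV : Type} (M : kripke PV).
Implicit Types (X Y Z : set M) (w : M) (f g : form PV) (a b : cform PV).

(** Induction on [a]. To rebuild a team from its points, the tensor case splits [X] into the points
    satisfying each factor, and the diamond case takes all successors of [X] that satisfy the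
    subformula. *)
Lemma csat_flat a X : csat X a <-> forall w, X w -> csat [set w] a.
Proof.
elim: a X => [p||a _|a IHa b IHb|a IHa b IHb|a IHa|a IHa] X /=.
- split=> [XV w Xw _ -> | XV w Xw]; [exact: XV | exact: (XV w)].
- split=> [-> //|X0]; apply/eqP/negPn/negP => /set0P[w Xw].
  by have := X0 w Xw; rewrite -subset0 => /(_ w erefl).
- by split=> [Xa w Xw _ -> | Xa w Xw]; [exact: Xa | exact: (Xa w Xw w erefl)].
- rewrite IHa IHb; split=> [[Xa Xb] w Xw|Xab].
    by split; [exact: Xa | exact: Xb].
  by split=> w /Xab[].
- split=> [[Y [Z [_ _ -> Ya Zb]]] w|Xab].
    move=> [Yw|Zw]; [exists [set w], set0 | exists set0, [set w]].
      by split=> //; rewrite ?setU0 ?IHb //; apply: (IHa Y).1.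
    by split=> //; rewrite ?set0U ?IHa //; apply: (IHb Z).1.
  exists [set w | X w /\ csat [set w] a], [set w | X w /\ csat [set w] b].
  split; rewrite ?IHa ?IHb; try by move=> w [].
  apply/seteqP; split=> w; last by move=> [] [].
  move=> Xw; have [Y [Z [_ _ E Ya Zb]]] := Xab w Xw.
  have : (Y `|` Z) w by rewrite -E.
  by move=> [?|?]; [left|right]; split=> //; [apply: (IHa Y).1|apply: (IHb Z).1].
- rewrite IHa; split=> [Xa w Xw|Xa v [w Xw wv]].
    by rewrite IHa => v [_ -> wv]; apply: Xa; exists w.
  by apply: (IHa (succs [set w])).1; [exact: Xa | exists w].
- split=> [[Y [YX XY] Ya] w Xw|Xa].
    have [v [Yv wv]] := XY w Xw.
    exists [set v]; last exact: (IHa Y).1.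
    by split=> [_ -> //|_ ->]; exists v.
  exists [set v | succs X v /\ csat [set v] a]; last by rewrite IHa => v [].
  split=> [v [] //|w Xw].
  have [Y [YX XY] Ya] := Xa w Xw; have [v [Yv wv]] := XY w erefl.
  exists v; split=> //; split; last exact: (IHa Y).1.
  by case: wv => _ -> wv; exists w.
Qed.

(** On a single point the tensor is Boolean disjunction: one part of the splitting contains the
    point, and the other may be empty, since the empty team satisfies every classical formula. *)
Lemma csat1_tens a b w :
  csat [set w] (cTens a b) <-> csat [set w] a \/ csat [set w] b.
Proof.
split=> /= [[Y [Z [_ _ E Ya Zb]]]|].
  have : (Y `|` Z) w by rewrite -E.
  by move=> [?|?]; [left; apply: (csat_flat a Y).1|right; apply: (csat_flat b Z).1].
have c0 c : csat (set0 : set M) c by apply/csat_flat.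
by move=> [wa|wb]; [exists [set w], set0|exists set0, [set w]];
  split; rewrite ?setU0 ?set0U.
Qed.

Lemma csat1_box a w : csat [set w] (cBox a) <-> forall v, acc w v -> csat [set v] a.
Proof.
rewrite /= csat_flat; split=> [wa v wv|wa v [_ -> wv]]; last exact: wa.
by apply: wa; exists w.
Qed.

Lemma csat1_dia a w :
  csat [set w] (cDia a) <-> exists2 v, acc w v & csat [set v] a.
Proof.
split=> [[Y [_ /(_ w erefl) [v [Yv [_ -> wv]]]] Ya]|[v wv va]].
  by exists v => //; apply: (csat_flat a Y).1.
by exists [set v] => //; split=> [_ ->|_ ->]; [exists w | exists v; split=> //; exists w].
Qed.

(** Validates ex falso, and tensor introduction with an empty second part. *)
Lemma sat_empty f : sat (set0 : set M) f.
Proof.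
have s0 : succs (set0 : set M) = set0 by rewrite -subset0 => v [].
elim: f => [p||a|n a b|f IHf g IHg|f IHf g IHg|f IHf g _|f IHf|f IHf] //=.
- by exists set0, set0; split; rewrite ?setU0.
- by left.
- by rewrite s0.
- by exists set0 => //; split=> w [].
Qed.

(** Witnesses for the larger team are cut down: the two parts of a tensor are intersected with [Y],
    the witness of a diamond with [succs Y]. *)
Lemma sat_down f X Y : sat X f -> Y `<=` X -> sat Y f.
Proof.
elim: f X Y => [p||a|n a b|f IHf g IHg|f IHf g IHg|f IHf g IHg|f IHf|f IHf] X Y /=.
- by move=> XV YX w /YX /XV.
- by move=> ->; rewrite subset0.
- by move=> Xa YX w /YX /Xa.
- by move=> Xab YX w u /YX Xw /YX; apply: Xab.
- by move=> [Xf Xg] YX; split; [apply: IHf Xf YX | apply: IHg Xg YX].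
- move=> [Z1 [Z2 [_ _ -> Xf Xg]]] YX; exists (Y `&` Z1), (Y `&` Z2).
  split; rewrite -?setIUr; try exact: subIsetl; first exact/esym/setIidPl.
    exact: IHf Xf (@subIsetr _ _ _).
  exact: IHg Xg (@subIsetr _ _ _).
- by move=> [Xf|Xg] YX; [left; apply: IHf Xf YX|right; apply: IHg Xg YX].
- by move=> Xf YX; apply: IHf Xf _ => v [w /YX Xw wv]; exists w.
- move=> [Z [ZX XZ] Zf] YX; exists (Z `&` succs Y); last exact: IHf Zf (@subIsetl _ _ _).
  split=> [v [] //|w Yw]; have [v [Zv [_ -> wv]]] := XZ w (YX w Yw).
  by exists v; split; [split=> //|]; exists w.
Qed.

Lemma sat_foldr_and (T : eqType) (F : T -> form PV) (s : seq T) f X :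
  sat X (foldr (@fAnd PV) f [seq F i | i <- s]) <->
  (forall i, i \in s -> sat X (F i)) /\ sat X f.
Proof.
elim: s => [|i s IHs] /=; first by split=> // -[].
rewrite IHs; split=> [[Xi [Xs Xf]]|[Xs Xf]].
  by split=> // j; rewrite inE => /orP[/eqP ->|/Xs].
split; first by apply: Xs; rewrite inE eqxx.
by split=> // j js; apply: Xs; rewrite inE js orbT.
Qed.

End Semantics.

(** * Semantics of the expansion of a dependence atom *)

Lemma sat_bigtens_cons (PV : Type) (M : kripke PV) (X : set M) f s :
  sat X (bigtens (f :: s)) <-> sat X (fTens f (bigtens s)).
Proof.
case: s => //=; split=> [Xf|[Y [Z [_ _ -> Yf ->]]]]; last by rewrite setU0.
by exists X, set0; split; rewrite ?setU0.
Qed.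

(** The pieces [Y v] cover [X], and downward closure cuts them back to subsets of [X]. Since [s] has
    no duplicates, the piece at its head can be redefined without disturbing the others. *)
Lemma sat_bigtens (PV : Type) (M : kripke PV) (T : eqType)
    (F : T -> form PV) (s : seq T) (X : set M) : uniq s ->
  sat X (bigtens [seq F v | v <- s]) <->
  exists2 Y : T -> set M, (forall w, X w -> exists2 v, v \in s & Y v w) &
    forall v, v \in s -> sat (Y v) (F v).
Proof.
elim: s X => [|v s IHs] X /=.
  split=> [->|[Y XY _]]; first by exists (fun=> set0).
  by rewrite -subset0 => w /XY [].
move=> /andP[vs us]; rewrite sat_bigtens_cons; split.
  move=> [Z [Z' [_ _ -> Zv /(IHs _ us) [Y ZY Ys]]]].
  exists (fun u => if u == v then Z else Y u) => [w [Zw|/ZY [u us' Yu]]|u].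
  - by exists v; rewrite ?inE eqxx.
  - exists u; first by rewrite inE us' orbT.
    by case: eqP => [uv|//]; rewrite -uv us' in vs.
  - by rewrite inE; case: eqP => [-> //|_ /Ys].
move=> [Y XY Ys]; exists (X `&` Y v), (X `&` [set w | exists2 u, u \in s & Y u w]).
split; try exact: subIsetl.
- apply/seteqP; split=> [w Xw|w [] [] //].
  have [u] := XY w Xw; rewrite inE => /orP[/eqP -> Yw|us' Yw]; [left|right] => //.
  by split=> //; exists u.
- by apply: sat_down (@subIsetr _ _ _); apply: Ys; rewrite inE eqxx.
- apply/(IHs _ us); exists Y => [w [] //|u us']; apply: Ys.
  by rewrite inE us' orbT.
Qed.

Lemma sat_dep_cell (PV : Type) (M : kripke PV) (n : nat)
    (a : n.-tuple (cform PV)) b v (X : set M) :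
  sat X (dep_cell a b v) <->
  (forall w, X w -> forall i, csat [set w] (tnth a i) <-> v i) /\
  ((forall w, X w -> csat [set w] b) \/ (forall w, X w -> ~ csat [set w] b)).
Proof.
rewrite /dep_cell sat_foldr_and /= sat_emb csat_flat.
suff E : (forall i, i \in enum 'I_n -> sat X (emb (cpow (tnth a i) (v i)))) <->
  (forall w, X w -> forall i, csat [set w] (tnth a i) <-> v i) by rewrite E.
split=> [Xa w Xw i|Xa i _].
  have := Xa i (mem_enum _ i); rewrite sat_emb /cpow; case: (v i) => [/csat_flat|/=].
    by move=> /(_ w Xw).
  by move=> /(_ w Xw) na; split.
rewrite sat_emb csat_flat => w Xw; have := Xa w Xw i; rewrite /cpow.
by case: (v i) => /= -[wa wa']; [exact: wa'|move=> _ -> /wa].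
Qed.

(** Points with the same truth values for the [tnth a i] belong to the cell of the same [v], and
    within one cell [b] is constant. Conversely, [X] is cut into cells according to these truth
    values, and the dependence atom makes [b] constant on each. *)
Lemma sat_dep_expansion (PV : Type) (M : kripke PV) (n : nat)
    (a : n.-tuple (cform PV)) b (X : set M) :
  sat X (dep_expansion a b) <-> sat X (fDep a b).
Proof.
rewrite /dep_expansion sat_bigtens ?enum_uniq //; split=> [[Y XY Ys] w u Xw Xu wu|Xab].
  have [v vs Yw] := XY w Xw; have [v' vs' Yu] := XY u Xu.
  have [Ya Yb] := (sat_dep_cell _ _ _ _).1 (Ys v vs).
  have [Ya' _] := (sat_dep_cell _ _ _ _).1 (Ys v' vs').
  have vv' : v = v'.
    by apply/ffunP => i; apply/idP/idP => /[dup];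
      [rewrite -{1}(Ya w Yw) wu (Ya' u Yu)|rewrite -{1}(Ya' u Yu) -wu (Ya w Yw)].
  rewrite -vv' in Yu; case: Yb => Yb; split=> // wb; try exact: Yb.
    by case: (Yb w Yw).
  by case: (Yb u Yu).
exists (fun v : {ffun 'I_n -> bool} =>
    [set w | X w /\ forall i, csat [set w] (tnth a i) <-> v i]) => [w Xw|v _].
  exists [ffun i => `[< csat [set w] (tnth a i) >]]; first by rewrite mem_enum.
  by split=> // i; rewrite ffunE asboolE.
rewrite sat_dep_cell; split=> [w []//|].
have [[w [[Xw wv] wb]]|nb] := pselect (exists w,
  (X w /\ forall i, csat [set w] (tnth a i) <-> v i) /\ csat [set w] b).
  by left=> u [Xu uv]; apply/(Xab w u) => // i; rewrite wv uv.
by right=> w wv wb; apply: nb; exists w.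
Qed.

(** * Soundness of the deduction rules *)

Theorem soundness (PV : Type) (G : set (form PV)) f : derivable G f -> entails G f.
Proof.
(* A discharged assumption may hold only on a part [Y] of the team; the remaining assumptions
   descend to [Y] by downward closure. *)
have add1 (M : kripke PV) (X Y : set M) (D : set (form PV)) g :
    (forall h, D h -> sat X h) -> Y `<=` X -> sat Y g ->
    forall h, (D `|` [set g]) h -> sat Y h.
  by move=> XD YX Yg h [/XD Xh|-> //]; apply: sat_down Xh YX.
move=> Gf M; elim: {G f}Gf.
- by move=> G f Gf X; apply.
- by move=> G f g _ IHf _ IHg X XG; split; [apply: IHf|apply: IHg].
- by move=> G f g _ IH X XG; case: (IH X XG).
- by move=> G f g _ IH X XG; case: (IH X XG).
- move=> G a _ IH X XG; rewrite sat_emb csat_flat => w Xw; apply: contrapT => wa.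
  by apply: (IH X XG w Xw) => _ ->.
- by move=> G f _ IH X XG; rewrite (IH X XG); apply: sat_empty.
- move=> G a _ IH X XG w Xw wa; have wX : [set w] `<=` X by move=> _ ->.
  suff : [set w] = set0 :> set M by rewrite -subset0 => /(_ w erefl).
  by apply: IH; apply: add1 XG wX _; rewrite sat_emb.
- move=> G a _ IHa _ IHn X XG; rewrite /= -subset0 => w Xw; apply: (IHn X XG w Xw).
  by apply: (csat_flat a X).1 => //; rewrite -sat_emb; apply: IHa.
- by move=> G k f g _ IHf _ IHg X XG; apply: IHg => _ [i _ <-]; apply: IHf.
- move=> G f g _ IHf _ IHg X XG; have [Y XY Yf] := IHf X XG.
  by exists Y => //; apply: IHg => _ ->.
- move=> G a _ IH X XG.
  (* The largest possible witness: all successors of the team at which [a] fails. *)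
  exists [set v | succs X v /\ ~ csat [set v] a]; last by move=> v [].
  split=> [v [] //|w Xw]; have := IH X XG w Xw.
  rewrite csat1_box => /existsNP[v /not_implyP[wv va]].
  by exists v; split; [split=> //|]; exists w.
- move=> G a _ IH X XG w Xw; have [Y [YX XY] Ya] := IH X XG.
  have [v [Yv [_ -> wv]]] := XY w Xw.
  by rewrite csat1_box => /(_ v wv); apply: Ya.
- by move=> G f g _ IH X XG; left; apply: IH.
- by move=> G f g _ IH X XG; right; apply: IH.
- move=> G f g h _ IH _ IHf _ IHg X XG.
  case: (IH X XG) => [Xf|Xg]; [apply: IHf|apply: IHg]; exact: add1 XG _ _.
- move=> G f g h _ IH X XG; have [Y [Z [YX ZX E Yf [Zg|Zh]]]] := IH X XG.
    by left; exists Y, Z.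
  by right; exists Y, Z.
- move=> G f g _ IH X XG; have [Y XY [Yf|Yg]] := IH X XG.
    by left; exists Y.
  by right; exists Y.
- by move=> G f g _ IH X XG; apply: IH.
- move=> G f g _ IH X XG; exists X, set0.
  by split; rewrite ?setU0 //; [exact: IH|exact: sat_empty].
- move=> G f g _ IH X XG; have [Y [Z [YX ZX E Yf Zg]]] := IH X XG.
  by exists Z, Y; rewrite setUC.
- move=> G f g h _ IH X XG; have [Y [Z [YX ZX E Yf [Z1 [Z2 [Z1Z Z2Z EZ Zg Zh]]]]]] := IH X XG.
  exists (Y `|` Z1), Z2; rewrite -setUA -EZ; split=> //.
  + by rewrite subUset; split=> // w /Z1Z /ZX.
  + by move=> w /Z2Z /ZX.
  + by exists Y, Z1; split.
- move=> G f g a _ IH _ IHf _ IHg X XG; have [Y [Z [YX ZX E Yf Zg]]] := IH X XG.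
  have Ya : csat Y a by rewrite -sat_emb; apply: IHf; apply: add1 XG YX Yf.
  have Za : csat Z a by rewrite -sat_emb; apply: IHg; apply: add1 XG ZX Zg.
  rewrite sat_emb csat_flat E => w [|] w'; [exact: (csat_flat a Y).1|exact: (csat_flat a Z).1].
- move=> G f g h _ IH _ IHg X XG; have [Y [Z [YX ZX E Yf Zg]]] := IH X XG.
  by exists Y, Z; split=> //; apply: IHg; apply: add1 XG ZX Zg.
- by move=> G n a b _ IH X XG; apply/sat_dep_expansion; apply: IH.
- by move=> G n a b _ IH X XG; apply/sat_dep_expansion; apply: IH.
Qed.

(** Classical equality on formulas, so that finite lists of assumptions have membership [\in]. *)
HB.instance Definition _ (PV : Type) := gen_eqMixin (form PV).

(** * Structural properties of derivability, and compactness *)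

Section ProofTheory.
Context {PV : Type}.
Implicit Types (G D : set (form PV)) (f g h : form PV) (a b : cform PV).

(** A discharged assumption is added to both contexts. The subderivations of [dBoxMon] and [dDiaMon]
    have contexts of their own and are kept unchanged. *)
Lemma derivable_weaken G D f : derivable G f -> G `<=` D -> derivable D f.
Proof.
move=> Gf; elim: {G f}Gf D;
  try by move=> > _ IH D GD; econstructor; exact: IH GD.
- by move=> G f Gf D GD; apply: dAssume; apply: GD.
- by move=> G f g _ IHf _ IHg D GD; apply: dAndI; [exact: IHf|exact: IHg].
- by move=> G a _ IH D GD; apply: dNegI; apply: IH; exact: setSU.
- by move=> G a _ IHa _ IHn D GD; apply: dNegE (IHa D GD) (IHn D GD).
- by move=> G k f g _ IHf fg _ D GD; apply: dBoxMon fg => i; exact: IHf.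
- by move=> G f g _ IHf fg _ D GD; apply: dDiaMon (IHf D GD) fg.
- move=> G f g h _ IH _ IHf _ IHg D GD.
  by apply: dOrE (IH D GD) (IHf _ _) (IHg _ _); exact: setSU.
- move=> G f g a _ IH _ IHf _ IHg D GD.
  by apply: dTensE (IH D GD) (IHf _ _) (IHg _ _); exact: setSU.
- move=> G f g h _ IH _ IHg D GD.
  by apply: dTensSub (IH D GD) (IHg _ _); exact: setSU.
Qed.

(** Each use of an assumption is replaced by its derivation, weakened by the discharged formulas in
    scope. *)
Lemma derivable_cut G D f :
  derivable G f -> (forall g, G g -> derivable D g) -> derivable D f.
Proof.
have add1 (G' D' : set (form PV)) g : (forall h, G' h -> derivable D' h) ->
    forall h, (G' `|` [set g]) h -> derivable (D' `|` [set g]) h.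
  move=> GD h [/GD Dh|hg]; last by apply: dAssume; right.
  exact: derivable_weaken Dh (@subsetUl _ _ _).
move=> Gf; elim: {G f}Gf D;
  try by move=> > _ IH D GD; econstructor; exact: IH GD.
- by move=> G f Gf D; apply.
- by move=> G f g _ IHf _ IHg D GD; apply: dAndI; [exact: IHf|exact: IHg].
- by move=> G a _ IH D GD; apply: dNegI; apply: IH; exact: add1.
- by move=> G a _ IHa _ IHn D GD; apply: dNegE (IHa D GD) (IHn D GD).
- by move=> G k f g _ IHf fg _ D GD; apply: dBoxMon fg => i; exact: IHf.
- by move=> G f g _ IHf fg _ D GD; apply: dDiaMon (IHf D GD) fg.
- move=> G f g h _ IH _ IHf _ IHg D GD.
  by apply: dOrE (IH D GD) (IHf _ _) (IHg _ _); exact: add1.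
- move=> G f g a _ IH _ IHf _ IHg D GD.
  by apply: dTensE (IH D GD) (IHf _ _) (IHg _ _); exact: add1.
- move=> G f g h _ IH _ IHg D GD.
  by apply: dTensSub (IH D GD) (IHg _ _); exact: add1.
Qed.

Lemma derivable_trans G f g :
  derivable G f -> derivable [set f] g -> derivable G g.
Proof. by move=> Gf fg; apply: derivable_cut fg _ => _ ->. Qed.

Lemma derivable1 f : derivable [set f] f.
Proof. exact: dAssume. Qed.

Lemma derivable_orE G f g h : derivable G (fOr f g) ->
  derivable [set f] h -> derivable [set g] h -> derivable G h.
Proof.
by move=> Gfg fh gh; apply: (dOrE Gfg); [move: fh|move: gh] => /derivable_weaken; apply;
  exact: subsetUr.
Qed.

Lemma derivable_or_mono G f g f' g' : derivable G (fOr f g) ->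
  derivable [set f] f' -> derivable [set g] g' -> derivable G (fOr f' g').
Proof.
by move=> Gfg ff' gg'; apply: (derivable_orE Gfg); [exact: dOrIl|exact: dOrIr].
Qed.

Lemma derivable_and_mono G f g f' g' : derivable G (fAnd f g) ->
  derivable [set f] f' -> derivable [set g] g' -> derivable G (fAnd f' g').
Proof.
move=> Gfg ff' gg'; apply: dAndI.
  exact: derivable_trans (dAndEl Gfg) ff'.
exact: derivable_trans (dAndEr Gfg) gg'.
Qed.

(** [dTensSub] rewrites the right factor only; commutativity brings the left one there. *)
Lemma derivable_tens_mono G f g f' g' : derivable G (fTens f g) ->
  derivable [set f] f' -> derivable [set g] g' -> derivable G (fTens f' g').
Proof.
move=> Gfg ff' gg'; apply: dTensC; apply: (dTensSub (g := f)); last first.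
  by apply: derivable_weaken ff' _; exact: subsetUr.
apply: dTensC; apply: (dTensSub Gfg).
by apply: derivable_weaken gg' _; exact: subsetUr.
Qed.

Lemma derivable_box_mono G f g :
  derivable G (fBox f) -> derivable [set f] g -> derivable G (fBox g).
Proof.
move=> Gf fg; apply: (dBoxMon (k := 1) (f := fun=> f)) => //.
by apply: derivable_weaken fg _ => _ ->; exists ord0.
Qed.

(** Serves the chain argument in Zorn's lemma and the passage from an infinite context to the
    finitely many premises of [dBoxMon]. *)
Lemma derivable_compact G f : derivable G f ->
  exists2 s : seq (form PV), (forall g, g \in s -> G g) & derivable [set` s] f.
Proof.
pose fin G f := exists2 s : seq (form PV),
  (forall g, g \in s -> G g) & derivable [set` s] f.
have fin2 G' f1 f2 : fin G' f1 -> fin G' f2 -> exists s : seq (form PV),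
    [/\ forall g, g \in s -> G' g, derivable [set` s] f1 & derivable [set` s] f2].
  move=> [s sG sf] [t tG tf]; exists (s ++ t); split.
  - by move=> g; rewrite mem_cat => /orP[/sG|/tG].
  - by apply: derivable_weaken sf _ => g /= gs; rewrite mem_cat gs.
  - by apply: derivable_weaken tf _ => g /= gs; rewrite mem_cat gs orbT.
(* Only the members of [G'] are kept in the list; the one formula that can get lost is the
   discharged one, which is added back explicitly. *)
have fin_add G' f1 f2 : fin (G' `|` [set f1]) f2 -> exists2 s : seq (form PV),
    (forall g, g \in s -> G' g) & derivable ([set` s] `|` [set f1]) f2.
  move=> [s sG sf]; exists [seq g <- s | `[< G' g >]].
    by move=> g; rewrite mem_filter => /andP[/asboolP].
  apply: derivable_weaken sf _ => g /= gs; have [G'g|->] := sG g gs; last by right.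
  by left; rewrite /= mem_filter gs andbT; apply/asboolP.
have fin_disch G' f1 f2 f3 : fin G' f1 -> fin (G' `|` [set f2]) f3 ->
    exists s : seq (form PV), [/\ forall g, g \in s -> G' g,
      derivable [set` s] f1 & derivable ([set` s] `|` [set f2]) f3].
  move=> [s sG sf] /fin_add[t tG tf]; exists (s ++ t); split.
  - by move=> g; rewrite mem_cat => /orP[/sG|/tG].
  - by apply: derivable_weaken sf _ => g /= gs; rewrite mem_cat gs.
  - apply: derivable_weaken tf _; apply: setSU => g /= gs.
    by rewrite mem_cat gs orbT.
have fin_disch2 G' f1 f2 f3 f4 : fin G' f1 -> fin (G' `|` [set f2]) f4 ->
    fin (G' `|` [set f3]) f4 -> exists s : seq (form PV), [/\ forall g, g \in s -> G' g,
      derivable [set` s] f1, derivable ([set` s] `|` [set f2]) f4 &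
      derivable ([set` s] `|` [set f3]) f4].
  move=> F1 F2 F3; have [s [sG sf2 sf4]] := fin_disch _ _ _ _ F1 F2.
  have [t tG tf] := fin_add _ _ _ F3.
  exists (s ++ t); split.
  - by move=> g; rewrite mem_cat => /orP[/sG|/tG].
  - by apply: derivable_weaken sf2 _ => g /= gs; rewrite mem_cat gs.
  - apply: derivable_weaken sf4 _; apply: setSU => g /= gs.
    by rewrite mem_cat gs.
  - apply: derivable_weaken tf _; apply: setSU => g /= gs.
    by rewrite mem_cat gs orbT.
move=> Gf; change (fin G f); elim: {G f}Gf;
  try by move=> *; match goal with H : fin _ _ |- fin _ _ =>
    case: H => s sG sf; exists s => //; econstructor; exact: sf end.
- move=> G f Gf; exists [:: f]; first by move=> g; rewrite inE => /eqP ->.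
  by apply: dAssume; rewrite /= inE.
- move=> G f g _ IHf _ IHg; have [s [sG sf sg]] := fin2 _ _ _ IHf IHg.
  by exists s => //; apply: dAndI.
- move=> G a _ /fin_add[s sG sa]; exists s => //; exact: dNegI.
- move=> G a _ IHf _ IHg; have [s [sG sf sg]] := fin2 _ _ _ IHf IHg.
  by exists s => //; apply: dNegE sf sg.
- move=> G k f g _ IHf fg _.
  suff [s sG sf] : exists2 s : seq (form PV), (forall g, g \in s -> G g) &
      forall i, derivable [set` s] (fBox (f i)) by exists s => //; apply: dBoxMon fg.
  (* The rule has finitely many premises, so concatenating one list for each gives a single finite
     list. *)
  have [t tP] := choice (fun i => (exists2P _ _).1 (IHf i)).
  exists (flatten [seq t i | i <- enum 'I_k]).
    by move=> h /flatten_mapP[i _ /(tP i).1].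
  move=> i; apply: derivable_weaken (tP i).2 _ => h /= hi.
  by apply/flatten_mapP; exists i => //; rewrite mem_enum.
- by move=> G f g _ [s sG sf] fg _; exists s => //; apply: dDiaMon sf fg.
- move=> G f g h _ IH _ IHf _ IHg; have [s [sG ? ? ?]] := fin_disch2 _ _ _ _ _ IH IHf IHg.
  by exists s => //; apply: dOrE; eauto.
- move=> G f g a _ IH _ IHf _ IHg; have [s [sG ? ? ?]] := fin_disch2 _ _ _ _ _ IH IHf IHg.
  by exists s => //; apply: dTensE; eauto.
- move=> G f g h _ IH _ IHf; have [s [sG ? ?]] := fin_disch _ _ _ _ IH IHf.
  by exists s => //; apply: dTensSub; eauto.
Qed.

Lemma derivable_box_closed G g :
  derivable [set f | G (fBox f)] g -> derivable G (fBox g).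
Proof.
move=> /derivable_compact[s sG sg].
apply: (dBoxMon (f := tnth (in_tuple s))) => [i|].
  by apply: dAssume; apply: sG; apply: mem_tnth.
by apply: derivable_weaken sg _ => f /= /(tnthP (in_tuple s))[i ->]; exists i.
Qed.

(** * Maximal theories *)

(** For [f := fBot] these are the maximal consistent sets; a general [f] is needed for the theory
    that witnesses the underivability of [f]. *)
Definition maximal_avoiding f D :=
  ~ derivable D f /\ forall g, ~ D g -> derivable (D `|` [set g]) f.

(** Zorn's lemma is applied to the sets [D] for which [G] together with [D] does not derive [f], so
    that the empty chain too has an upper bound. *)
Lemma lindenbaum G f : ~ derivable G f ->
  exists2 D, G `<=` D & maximal_avoiding f D.
Proof.
move=> Gf; have [F FP|D [Df Dmax]] :=
  @Zorn_bigcup _ [set D | ~ derivable (G `|` D) f].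
  move=> Ftot /= /derivable_compact[s sF sf].
  (* Finitely many assumptions already occur in [G] and one member of the chain; [set0] stands in
     when no member has been selected. *)
  suff [X [->|FX] sX] : exists2 X, (X = set0 \/ F X) & [set` s] `<=` G `|` X.
  - by apply: Gf; apply: derivable_weaken sf _; rewrite -[G]setU0.
  - by apply: (FP X FX); apply: derivable_weaken sf _.
  elim: s sF {sf} => [_|g s IHs sF]; first by exists set0; [left|move=> g].
  have [g' gs|X FX sX] := IHs; first by apply: sF; rewrite inE gs orbT.
  have consP Y : (G `|` Y) g -> G `|` X `<=` G `|` Y ->
      [set` g :: s] `<=` G `|` Y.
    by move=> Yg XY h /=; rewrite inE => /orP[/eqP -> //|/sX /XY].
  have [Gg|[Y FY Yg]] := sF g (mem_head _ _).
    by exists X => //; apply: consP => //; left.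
  case: FX => [X0|FX].
    by exists Y; [right|apply: consP; [right|rewrite X0 setU0; exact: subsetUl]].
  have [XY|YX] := Ftot _ _ FX FY.
    by exists Y; [right|apply: consP; [right|exact: setUS]].
  by exists X; [right|apply: consP => //; right; apply: YX].
exists (G `|` D); first exact: subsetUl.
split=> // g Dg; apply: contrapT => Dgf.
apply: (Dmax (D `|` [set g])); last by rewrite /= setUA.
split; first exact: subsetUl.
by move=> /(_ g (or_intror erefl)) gD; apply: Dg; right.
Qed.

Section Maximal.
Variables (f : form PV) (D : set (form PV)).
Hypothesis Dmax : maximal_avoiding f D.

Lemma maximal_closed g : derivable D g -> D g.
Proof.
case: Dmax => Df Dm Dg; apply: contrapT => /Dm /derivable_cut Dgf.
by apply: Df; apply: Dgf => h [Dh|-> //]; apply: dAssume.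
Qed.

Lemma maximal_or g h : D (fOr g h) -> D g \/ D h.
Proof.
case: Dmax => Df Dm Dgh; apply: contrapT => /not_orP[/Dm Dg /Dm Dh].
by apply: Df; apply: dOrE Dg Dh; apply: dAssume.
Qed.

End Maximal.

Lemma derivable_by_contra G a :
  derivable (G `|` [set fNeg a]) fBot -> derivable G (emb a).
Proof. by move=> Ga; apply: dNegNegE; apply: (dNegI (a := cNeg a)). Qed.

(** The rules relate negated boxes to diamonds of negations; taken at [cNeg a], with a double
    negation introduced under the diamond, they give this half of the duality. *)
Lemma derivable_dia_neg a : derivable [set fDia (emb a)] (fNeg (cBox (cNeg a))).
Proof.
apply: (dDiaNeg (a := cNeg a)); apply: (dDiaMon (derivable1 _)).
apply: dNegI; apply: (dNegE (a := a)); apply: dAssume; [by left|by right].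
Qed.

Lemma derivable_negbox a : derivable [set fNeg (cBox (cNeg a))] (fDia (emb a)).
Proof.
apply: (dDiaMon (dNegBox (derivable1 _))); apply: dNegNegE; exact: derivable1.
Qed.

(** * Disjunctive normal form *)

Inductive classical_disj : form PV -> Prop :=
| disj_emb a : classical_disj (emb a)
| disj_or f g : classical_disj f -> classical_disj g -> classical_disj (fOr f g).

Definition normalizable f := exists g,
  [/\ classical_disj g, derivable [set f] g & derivable [set g] f].

Lemma normalizable_equiv f g :
  derivable [set f] g -> derivable [set g] f -> normalizable g -> normalizable f.
Proof.
move=> fg gf [h [hd gh hg]]; exists h; split=> //.
  exact: derivable_trans fg gh.
exact: derivable_trans hg gf.
Qed.

Lemma normalizable_emb a : normalizable (emb a).
Proof. by exists (emb a); split; [exact: disj_emb|exact: derivable1|exact: derivable1]. Qed.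

Lemma normalizable_or f g :
  normalizable f -> normalizable g -> normalizable (fOr f g).
Proof.
move=> [f' [f'd ff' f'f]] [g' [g'd gg' g'g]]; exists (fOr f' g'); split.
- exact: disj_or.
- exact: derivable_or_mono (derivable1 _) ff' gg'.
- exact: derivable_or_mono (derivable1 _) f'f g'g.
Qed.

(** Monotonicity replaces the argument by its normal form; distributivity, whose converse is again
    monotonicity, then moves [op] down to the classical disjuncts. *)
Lemma normalizable_unary (op : form PV -> form PV) (cop : cform PV -> cform PV) :
  (forall a, op (emb a) = emb (cop a)) ->
  (forall f g, derivable [set f] g -> derivable [set op f] (op g)) ->
  (forall f g, derivable [set op (fOr f g)] (fOr (op f) (op g))) ->
  forall f, normalizable f -> normalizable (op f).
Proof.
move=> opE op_mono op_or f [g [gd fg gf]].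
apply: (normalizable_equiv (op_mono _ _ fg) (op_mono _ _ gf)).
elim: gd => [a|g1 g2 _ IH1 _ IH2]; first by rewrite opE; apply: normalizable_emb.
apply: (normalizable_equiv (op_or _ _)); last exact: normalizable_or.
by apply: derivable_orE (derivable1 _) _ _; apply: op_mono;
  [apply: dOrIl|apply: dOrIr]; exact: derivable1.
Qed.

(** As in the unary case, with commutativity moving either argument to the right, where monotonicity
    and distributivity are assumed. *)
Lemma normalizable_binary (op : form PV -> form PV -> form PV)
    (cop : cform PV -> cform PV -> cform PV) :
  (forall a b, op (emb a) (emb b) = emb (cop a b)) ->
  (forall f g, derivable [set op f g] (op g f)) ->
  (forall f g h, derivable [set g] h -> derivable [set op f g] (op f h)) ->
  (forall f g h, derivable [set op f (fOr g h)] (fOr (op f g) (op f h))) ->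
  forall f g, normalizable f -> normalizable g -> normalizable (op f g).
Proof.
move=> opE opC op_mono op_or f g [f' [f'd ff' f'f]] [g' [g'd gg' g'g]].
have swap h k : normalizable (op h k) -> normalizable (op k h).
  exact: normalizable_equiv.
apply: (normalizable_equiv (op_mono f _ _ gg') (op_mono f _ _ g'g)).
apply: (swap); apply: (normalizable_equiv (op_mono _ _ _ ff') (op_mono _ _ _ f'f)).
have distr h k1 k2 : normalizable (op h k1) -> normalizable (op h k2) ->
    normalizable (op h (fOr k1 k2)).
  move=> n1 n2; apply: (normalizable_equiv (op_or _ _ _)); last exact: normalizable_or.
  by apply: derivable_orE (derivable1 _) _ _; apply: op_mono;
    [apply: dOrIl|apply: dOrIr]; exact: derivable1.
elim: f'd {ff' f'f} => [a|f1 f2 _ IH1 _ IH2]; last exact: distr.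
apply: (swap); elim: g'd {gg' g'g} => [b|g1 g2 _ IH1 _ IH2]; last exact: distr.
by rewrite opE; apply: normalizable_emb.
Qed.

Lemma normalizable_and f g :
  normalizable f -> normalizable g -> normalizable (fAnd f g).
Proof.
apply: (@normalizable_binary (@fAnd PV) (@cAnd PV)) => // {}f {}g.
- apply: dAndI; [apply: dAndEr|apply: dAndEl]; exact: derivable1.
- by move=> h gh; apply: derivable_and_mono (derivable1 _) (derivable1 _) gh.
- move=> h; have fgh := derivable1 (fAnd f (fOr g h)).
  by apply: (dOrE (dAndEr fgh)); [apply: dOrIl|apply: dOrIr]; apply: dAndI;
    try (by apply: dAssume; right); apply: dAndEl; apply: dAssume; left.
Qed.

Lemma normalizable_tens f g :
  normalizable f -> normalizable g -> normalizable (fTens f g).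
Proof.
apply: (@normalizable_binary (@fTens PV) (@cTens PV)) => // {}f {}g.
- apply: dTensC; exact: derivable1.
- by move=> h gh; apply: derivable_tens_mono (derivable1 _) (derivable1 _) gh.
- by move=> h; apply: dTensOr; exact: derivable1.
Qed.

Lemma normalizable_box f : normalizable f -> normalizable (fBox f).
Proof.
apply: (@normalizable_unary (@fBox PV) (@cBox PV)) => // {}f g.
- exact: derivable_box_mono (derivable1 _).
- by apply: dBoxOr; exact: derivable1.
Qed.

Lemma normalizable_dia f : normalizable f -> normalizable (fDia f).
Proof.
apply: (@normalizable_unary (@fDia PV) (@cDia PV)) => // {}f g.
- exact: dDiaMon (derivable1 _).
- by apply: dDiaOr; exact: derivable1.
Qed.

Lemma normalizable_dep (n : nat) (a : n.-tuple (cform PV)) b :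
  normalizable (fDep a b).
Proof.
apply: (@normalizable_equiv _ (dep_expansion a b)).
- by apply: dDepE; exact: derivable1.
- by apply: dDepI; exact: derivable1.
(* The induction over lists reaches the empty tensor, which is [fBot] and so classical. *)
rewrite /dep_expansion; elim: (enum _) => [|v s IHs] /=.
  exact: (normalizable_emb cBot).
have nv : normalizable (dep_cell a b v).
  rewrite /dep_cell; elim: (enum _) => [|i t IHt] /=.
    by apply: normalizable_or; [|exact: (normalizable_emb (cNeg b))];
      exact: normalizable_emb.
  by apply: normalizable_and => //; exact: normalizable_emb.
by case: s IHs => // u s; apply: normalizable_tens.
Qed.

Lemma normal_form f : normalizable f.
Proof.
elim: f => [p||a|n a b|f IHf g IHg|f IHf g IHg|f IHf g IHg|f IHf|f IHf].
- exact: (normalizable_emb (cVar p)).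
- exact: (normalizable_emb cBot).
- exact: (normalizable_emb (cNeg a)).
- exact: normalizable_dep.
- exact: normalizable_and.
- exact: normalizable_tens.
- exact: normalizable_or.
- exact: normalizable_box.
- exact: normalizable_dia.
Qed.

(** [D] contains the normal form of [g], and primeness selects one of its classical disjuncts. *)
Lemma maximal_classical f D g : maximal_avoiding f D -> D g ->
  exists2 a, D (emb a) & derivable [set emb a] g.
Proof.
move=> Dm Dg; have [h [hd gh hg]] := normal_form g.
have : D h by apply: (maximal_closed Dm); apply: derivable_trans gh; apply: dAssume.
elim: hd g {Dg gh} hg => [a g ag Da|h1 h2 _ IH1 _ IH2 g hg]; first by exists a.
case/(maximal_or Dm); [apply: IH1|apply: IH2]; apply: derivable_trans hg;
  [apply: dOrIl|apply: dOrIr]; exact: derivable1.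
Qed.

(** By soundness the normal form of [g] holds on [X]; a team satisfies an intuitionistic disjunction
    only through one disjunct. *)
Lemma sat_classical (M : kripke PV) (X : set M) g : sat X g ->
  exists2 a, csat X a & derivable [set emb a] g.
Proof.
have [h [hd gh hg]] := normal_form g.
have sgh : sat X g -> sat X h by move=> Xg; apply: (soundness gh) => _ ->.
move=> /sgh; elim: hd g {gh sgh} hg => [a g ag|h1 h2 _ IH1 _ IH2 g hg].
  by rewrite sat_emb; exists a.
case; [apply: IH1|apply: IH2]; apply: derivable_trans hg;
  [apply: dOrIl|apply: dOrIr]; exact: derivable1.
Qed.

(** * Canonical model *)

Definition canonical_world := {D : set (form PV) | maximal_avoiding fBot D}.

Lemma canonical_world_of D : ~ derivable D fBot ->
  exists w : canonical_world, D `<=` sval w.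
Proof. by move=> /lindenbaum[E DE Em]; exists (exist _ E Em). Qed.

Lemma canonical_world_inhabited : inhabited canonical_world.
Proof.
have [|w _] := @canonical_world_of set0; last by split.
(* Consistency of the empty context: the full team of a one-point model refutes [fBot]. *)
move=> /soundness /(_ (@Kripke PV unit (inhabits tt) (fun _ _ => True) (fun=> set0)) setT).
by rewrite /= -subset0 => /(_ (fun g => False_ind _)) /(_ tt I).
Qed.

(** Accessibility ranges over all formulas [g], classical or not, in accordance with the context in
    [derivable_box_closed]. *)
Definition canonical_model : kripke PV := @Kripke PV canonical_world
  canonical_world_inhabited (fun w v => forall g, sval w (fBox g) -> sval v g)
  (fun p => [set w | sval w (fVar p)]).

Lemma canonical_closed (w : canonical_model) g : derivable (sval w) g -> sval w g.
Proof. exact: maximal_closed (svalP w) _. Qed.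

Lemma canonical_neg (w : canonical_model) a :
  sval w (fNeg a) <-> ~ sval w (emb a).
Proof.
have [wbot wmax] := svalP w; split=> [wna wa|/wmax wa].
  by apply: wbot; apply: (dNegE (a := a)); apply: dAssume.
by apply: canonical_closed; apply: dNegI.
Qed.

(** If the formulas boxed in [w] were inconsistent with the negation of [a], they would derive [a],
    and [w] would contain its box. *)
Lemma canonical_acc (w : canonical_model) a : ~ sval w (fBox (emb a)) ->
  exists2 v : canonical_model, acc w v & sval v (fNeg a).
Proof.
move=> wa; have [|v vP] :=
  @canonical_world_of ([set g | sval w (fBox g)] `|` [set fNeg a]).
  by move=> /derivable_by_contra /derivable_box_closed /canonical_closed.
by exists v; [move=> g wg|]; apply: vP; [left|right].
Qed.

(** Single points suffice, as flatness extends the result to teams. The diamond case goes through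
    the dual box. *)
Lemma truth_lemma a (w : canonical_model) : csat [set w] a <-> sval w (emb a).
Proof.
elim: a w => [p||a IHa|a IHa b IHb|a IHa b IHb|a IHa|a IHa] w.
- by split=> /= [|wp _ ->]; [exact|].
- split=> [|/(@dAssume _ _ _) w0]; first by rewrite /= -subset0 => /(_ w erefl).
  by case: (svalP w).
- rewrite /= canonical_neg -IHa; split=> [|wa _ -> //]; exact.
- rewrite /= IHa IHb; split=> [[wa wb]|wab].
    by apply: canonical_closed; apply: dAndI; apply: dAssume.
  by split; apply: canonical_closed; [apply: dAndEl|apply: dAndEr]; apply: dAssume; eauto.
- rewrite csat1_tens IHa IHb /=; split.
    by case=> wa; apply: canonical_closed; [|apply: dTensC]; apply: dTensI; apply: dAssume.
  move=> wab; apply: contrapT => /not_orP[wa wb].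
  have [wbot wmax] := svalP w; apply: wbot.
  (* Tensor elimination requires a classical conclusion, here falsum, which maximality of [w] yields
     from each factor missing from [w]. *)
  by apply: (dTensE (a := cBot) (dAssume wab)); apply: wmax.
- rewrite csat1_box /=; split=> [wa|wa v wv]; last by apply/IHa; apply: wv.
  by apply: contrapT => /canonical_acc[v /wa /IHa va /canonical_neg].
- rewrite csat1_dia /=; split=> [[v wv /IHa va]|wa].
    apply: canonical_closed; apply: derivable_trans (derivable_negbox a).
    apply: dAssume; apply/canonical_neg => /wv /canonical_neg; exact.
  have /canonical_acc[v wv] : ~ sval w (fBox (emb (cNeg a))).
    apply/(canonical_neg w (cBox (cNeg a))); apply: canonical_closed.
    by apply: derivable_trans (derivable_dia_neg a); apply: dAssume.
  move=> vna; exists v => //; apply/IHa; apply: canonical_closed.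
  by apply: dNegNegE; apply: dAssume.
Qed.

Theorem completeness G f : entails G f -> derivable G f.
Proof.
move=> Gf; apply: contrapT => /lindenbaum[D GD Dm].
pose X : set canonical_model := [set w | D `<=` sval w].
have /sat_classical[a Xa af] : sat X f.
  apply: Gf => g /GD /(maximal_classical Dm)[a Da ag].
  apply: (soundness ag) => _ ->; rewrite sat_emb csat_flat => w Dw.
  by apply/truth_lemma; apply: Dw.
(* This set is consistent, for otherwise [D] would derive [a] and hence [f]. The resulting world
   lies in [X] but contains the negation of [a]. *)
have [Df _] := Dm; have [|w Dw] := @canonical_world_of (D `|` [set fNeg a]).
  by move=> /derivable_by_contra Da; apply: Df; apply: derivable_trans Da af.
have /canonical_neg : sval w (fNeg a) by apply: Dw; right.
apply; apply/truth_lemma; apply: (csat_flat a X).1 => // g Dg.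
by apply: Dw; left.
Qed.

End ProofTheory.

Theorem corollary2p14 (PV : Type) (G : set (form PV)) (f : form PV) :
  entails G f <-> derivable G f.
Proof. by split; [exact: completeness|exact: soundness]. Qed.
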